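(* Let $\mathcal{A}$ be a unital Banach algebra, let $I$ and $J$ be arbitrary index sets, and let $P$ be a $J\times I$ matrix over $\mathcal{A}$ such that all of its non-zero entries are invertible and $\|P\|_\infty=\sup\{\|P_{ji}\|: j\in J, i\in I\}\le 1$. If $\mathcal{A}$ is bounded $\omega^*$-approximately weakly amenable, then so is the $\ell^1$-Munn algebra $LM(\mathcal{A},P)$.
   Context: $LM(\mathcal{A},P)$ is the Banach space $\ell^1(I\times J,\mathcal{A})$ of all $I\times J$ matrices $X$ over $\mathcal{A}$ with $\|X\|_1=\sum_{i,j}\|X_{ij}\|<\infty$, made into a Banach algebra by the product $X\circ Y=XPY$. For a Banach algebra $\mathcal{C}$, the dual $\mathcal{C}^*$ is a Banach $\mathcal{C}$-bimodule via $\langle a\cdot f,b\rangle=\langle f,ba\rangle$, $\langle f\cdot a,b\rangle=\langle f,ab\rangle$; for $x\in\mathcal{C}^*$, $\mathrm{ad}_x:\mathcal{C}\to\mathcal{C}^*$ is $\mathrm{ad}_x(a)=a\cdot x-x\cdot a$. A derivation $D:\mathcal{C}\to\mathcal{C}^*$ is a bounded linear map with $D(ab)=D(a)\cdot b+a\cdot D(b)$ for all $a,b\in\mathcal{C}$. $\mathcal{C}$ is bounded $\omega^*$-approximately weakly amenable if for every continuous derivation $D:\mathcal{C}\to\mathcal{C}^*$ there is a net $(x_\alpha)$ in $\mathcal{C}^*$ such that the net $(\mathrm{ad}_{x_\alpha})$ is norm bounded in $B(\mathcal{C},\mathcal{C}^* )$, the space of bounded linear maps from $\mathcal{C}$ to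 $\mathcal{C}^*$, and $D(a)=\omega^*\text{-}\lim_\alpha \mathrm{ad}_{x_\alpha}(a)$ (weak-* limit in $\mathcal{C}^*$) for all $a\in\mathcal{C}$.
   Formalization: The formal theorem also assumes that P has a non-zero entry when I and J are non-empty; for P = 0 and A = C the product on LM(A,P) is zero, every bounded linear map is a derivation and every ad_x is 0, so the claim fails. *)

(* Defs.v *)
From HB Require Import structures.
From mathcomp Require Import all_boot all_order all_algebra finmap complex.
From mathcomp Require Import all_classical all_reals.
From mathcomp Require Import ereal topology normedtype sequences esum.
From mathcomp Require Import showcase.summability.

Set Implicit Arguments.
Unset Strict Implicit.
Unset Printing Implicit Defensive.

Import Order.TTheory GRing.Theory Num.Theory.
Import numFieldNormedType.Exports.
Local Open Scope classical_set_scope.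
Local Open Scope ring_scope.
Local Open Scope complex_scope.

(* Scalars are R[i], so the library norm `|x| is valued in R[i]; [rnorm] is the
   same norm read in R, as needed for suprema and extended-real sums. *)
Section RealNorm.
Context {R : realType}.

Definition rnorm (V : normedZmodType R[i]) (x : V) : R := complex.Re `|x|.

Lemma rnormE (V : normedZmodType R[i]) (x : V) : `|x| = (rnorm x)%:C.
Proof. by rewrite /rnorm RRe_real// ger0_real. Qed.

Lemma rnorm_ge0 (V : normedZmodType R[i]) (x : V) : 0 <= rnorm x.
Proof. by rewrite -ler0c -rnormE. Qed.

Lemma rnormD (V : normedZmodType R[i]) (x y : V) :
  rnorm (x + y) <= rnorm x + rnorm y.
Proof. by rewrite -lecR rmorphD/= -!rnormE ler_normD. Qed.

Lemma rnormZ (V : normedModType R[i]) (k : R[i]) (x : V) :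
  rnorm (k *: x) = rnorm k * rnorm x.
Proof. by apply: complexI; rewrite rmorphM/= -!rnormE normrZ. Qed.

Lemma rnorm0 (V : normedZmodType R[i]) : rnorm (0 : V) = 0.
Proof. by rewrite /rnorm normr0. Qed.

Lemma rnormN (V : normedZmodType R[i]) (x : V) : rnorm (- x) = rnorm x.
Proof. by rewrite /rnorm normrN. Qed.

Lemma rnorm_eq0 (V : normedZmodType R[i]) (x : V) : rnorm x = 0 -> x = 0.
Proof. by move=> x0; apply: normr0_eq0; rewrite rnormE x0. Qed.

End RealNorm.

Section Bounded.
Context {R : realType}.
Variables (V W : normedModType R[i]).

Definition blin : {pred V -> W} := fun f => `[< linear f /\ continuous f >].

Lemma blinP (f : V -> W) :
  (f \in blin) <-> linear f /\ exists M : R, forall x, `|f x| <= M%:C * `|x|.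
Proof.
split=> [/asboolP[lf cf]|[lf [M Mf]]].
  split=> //.
  pose g : {linear V -> W} := HB.pack f (GRing.isLinear.Build _ _ _ _ f lf).
  have /linear_boundedP : bounded_near g (nbhs 0).
    exact/(linear_bounded_continuous g).
  move=> /pinfty_ex_gt0[M M0 Mf]; exists (complex.Re M).
  by rewrite RRe_real ?gtr0_real.
apply/asboolP; split=> //.
pose g : {linear V -> W} := HB.pack f (GRing.isLinear.Build _ _ _ _ f lf).
apply: (bounded_linear_continuous (f := g)); apply/linear_boundedP.
near=> r => x; apply: le_trans (Mf x) _; apply: ler_wpM2r => //.
near: r; apply: nbhs_pinfty_ge.
exact/complex_realP/(ex_intro _ M).
Unshelve. all: by end_near. Qed.

Lemma blin_submod : submod_closed blin.
Proof.
split.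
  apply/blinP; split=> [k x y|].
    by rewrite -![(0 : V -> W) _]/(0 : W) scaler0 addr0.
  by exists 0 => x; rewrite -[(0 : V -> W) _]/(0 : W) normr0 mul0r.
move=> k f g /blinP[lf [M Mf]] /blinP[lg [N Ng]].
have E x : (k *: f + g) x = k *: f x + g x by [].
apply/blinP; split.
  move=> l x y; rewrite !E lf lg !scalerDr !scalerA mulrC.
  by rewrite addrACA.
exists (rnorm k * M + N) => x; rewrite E (le_trans (ler_normD _ _))//.
rewrite rmorphD rmorphM/= -rnormE mulrDl lerD// normrZ -mulrA.
exact: ler_wpM2l.
Qed.

HB.instance Definition _ := GRing.isSubmodClosed.Build R[i] (V -> W) blin blin_submod.

(* B(V, W): the bounded linear maps, with the operator norm [opnorm] below. *)
Record bop := Bop { bop_fun :> V -> W; bopP : bop_fun \in blin }.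

HB.instance Definition _ := [isSub for bop_fun].
HB.instance Definition _ := [Choice of bop by <:].
HB.instance Definition _ := [SubChoice_isSubLmodule of bop by <:].

Lemma bop_linear (f : bop) : linear f.
Proof. by have /blinP[] := bopP f. Qed.

HB.instance Definition _ (f : bop) :=
  GRing.isLinear.Build R[i] V W *:%R f (bop_linear f).

Lemma bop_eq (f g : bop) : f =1 g -> f = g.
Proof. by move=> fg; apply/val_inj/funext. Qed.

Lemma bopDE (f g : bop) x : (f + g) x = f x + g x. Proof. by []. Qed.
Lemma bopBE (f g : bop) x : (f - g) x = f x - g x. Proof. by []. Qed.
Lemma bopZE k (f : bop) x : (k *: f) x = k *: f x. Proof. by []. Qed.
Lemma bopNE (f : bop) x : (- f) x = - f x. Proof. by []. Qed.
Lemma bop0E x : (0 : bop) x = 0. Proof. by []. Qed.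

Definition opnorm (f : bop) : R := sup [set rnorm (f x) | x in [set x | `|x| <= 1]].

Lemma opnorm_has_sup (f : bop) :
  has_sup [set rnorm (f x) | x in [set x | `|x| <= 1]].
Proof.
split; first by exists (rnorm (f 0)), 0 => //=; rewrite normr0 ler01.
have /blinP[_ [M Mf]] := bopP f.
exists `|M| => _ [x /= x1 <-].
rewrite -lecR -rnormE (le_trans (Mf x))// (@le_trans _ _ (`|M|%:C * `|x|))//.
  by rewrite ler_wpM2r// lecR ler_norm.
by rewrite ler_piMr// ler0c.
Qed.

Lemma opnorm_ub (f : bop) x : `|f x| <= (opnorm f)%:C * `|x|.
Proof.
have [->|x0] := eqVneq x 0; first by rewrite linear0 !normr0 mulr0.
have nx0 : 0 < `|x| by rewrite normr_gt0.
rewrite -ler_pdivrMr// -[X in X / _]mulr1 -mulrA mul1r.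
have -> : `|f x| * `|x|^-1 = `|f (`|x|^-1 *: x)|.
  by rewrite linearZ normrZ normfV normr_id mulrC.
rewrite rnormE lecR; apply: ub_le_sup; first by have [] := opnorm_has_sup f.
by exists (`|x|^-1 *: x) => //=; rewrite normrZ normfV normr_id mulVf// gt_eqF.
Qed.

Lemma opnorm_le (f : bop) (M : R) :
  (forall x, `|x| <= 1 -> `|f x| <= M%:C) -> opnorm f <= M.
Proof.
move=> Mf; apply: ge_sup; first by have [] := opnorm_has_sup f.
by move=> _ [x /= x1 <-]; rewrite -lecR -rnormE Mf.
Qed.

Lemma opnorm_ge0 (f : bop) : 0 <= opnorm f.
Proof.
apply: le_trans (rnorm_ge0 (f 0)) _.
apply: ub_le_sup; first by have [] := opnorm_has_sup f.
by exists 0 => //=; rewrite normr0 ler01.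
Qed.

Lemma opnorm_eq0 (f : bop) : (opnorm f)%:C = 0 -> f = 0.
Proof.
move=> f0; apply: bop_eq => x; apply/eqP.
by rewrite -normr_le0 (le_trans (opnorm_ub f x))// f0 mul0r.
Qed.

Lemma opnormD (f g : bop) :
  (opnorm (f + g))%:C <= (opnorm f)%:C + (opnorm g)%:C.
Proof.
rewrite -rmorphD lecR; apply: opnorm_le => x x1.
rewrite bopDE (le_trans (ler_normD _ _))// rmorphD/= lerD//.
  by rewrite (le_trans (opnorm_ub _ _))// ler_piMr// ler0c opnorm_ge0.
by rewrite (le_trans (opnorm_ub _ _))// ler_piMr// ler0c opnorm_ge0.
Qed.

Lemma opnormZle (k : R[i]) (f : bop) : opnorm (k *: f) <= rnorm k * opnorm f.
Proof.
apply: opnorm_le => x x1.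
rewrite bopZE normrZ rmorphM/= -rnormE ler_wpM2l//.
by rewrite (le_trans (opnorm_ub _ _))// ler_piMr// ler0c opnorm_ge0.
Qed.

Lemma opnormZ (k : R[i]) (f : bop) :
  (opnorm (k *: f))%:C = `|k| * (opnorm f)%:C.
Proof.
rewrite (rnormE k) -rmorphM; congr _%:C; apply/eqP.
rewrite eq_le opnormZle/=.
have [->|k0] := eqVneq k 0; first by rewrite rnorm0 mul0r opnorm_ge0.
have := opnormZle k^-1 (k *: f); rewrite scalerA mulVf// scale1r => le.
have rk0 : 0 < rnorm k by rewrite -ltcR -rnormE normr_gt0.
rewrite -ler_pdivlMl//; suff <- : rnorm k^-1 = (rnorm k)^-1 by [].
by apply: complexI; rewrite -rnormE normfV rnormE fmorphV.
Qed.

HB.instance Definition _ :=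
  Lmodule_isNormed.Build R[i] bop opnormD opnormZ opnorm_eq0.

Lemma bop_normE (f : bop) : `|f| = (opnorm f)%:C. Proof. by []. Qed.

End Bounded.

Arguments blin {R V W}.

(* V^* carries the operator norm; the codomain is R[i] as a module over itself. *)
Notation dual V := (bop V ((complex _)^o)).

(* Complex Banach algebras, not necessarily unital: the library ring structures
   all have a unit, hence the separate multiplication [bmul]. *)
HB.mixin Record CompleteNormedModule_isBanachAlgebra (R : realType) A
    of CompleteNormedModule R[i] A := {
  bmul : A -> A -> A;
  bmulA : associative bmul;
  bmulDl : left_distributive bmul +%R;
  bmulDr : right_distributive bmul +%R;
  bmulZl : forall (k : R[i]) a b, bmul (k *: a) b = k *: bmul a b;
  bmulZr : forall (k : R[i]) a b, bmul a (k *: b) = k *: bmul a b;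
  ler_norm_bmul : forall a b, `|bmul a b| <= `|a| * `|b|;
}.

#[short(type="banachAlgType")]
HB.structure Definition BanachAlgebra (R : realType) :=
  {A of CompleteNormedModule R[i] A & CompleteNormedModule_isBanachAlgebra R A}.

(* `|bone| = 1 is not required. *)
HB.mixin Record BanachAlgebra_isUnital (R : realType) A
    of BanachAlgebra R A := {
  bone : A;
  bmul1l : left_id bone bmul;
  bmul1r : right_id bone bmul;
}.

#[short(type="unitalBanachAlgType")]
HB.structure Definition UnitalBanachAlgebra (R : realType) :=
  {A of BanachAlgebra R A & BanachAlgebra_isUnital R A}.

Arguments bone {R s}.

Definition binvertible {R : realType} {A : unitalBanachAlgType R} (a : A) :=
  exists b, bmul a b = bone /\ bmul b a = bone.

Section Amenability.
Context {R : realType} {A : banachAlgType R}.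
Implicit Types (a b c : A) (f x : dual A).

Lemma comp_blin (g : A -> A) (V : normedModType R[i]) (f : bop A V)
    (M : R[i]) :
  linear g -> (forall a, `|g a| <= M * `|a|) -> (f \o g : A -> V) \in blin.
Proof.
move=> lg Mg; apply/blinP; split=> [k a b|]; first by rewrite /= lg linearP.
have [M0|M0] := boolP (0 <= M); last first.
  exists 0 => a; suff -> : a = 0 by rewrite /= (_ : g 0 = 0) ?linear0 ?normr0 ?mulr0//;
    by have := lg (-1) 0 0; rewrite scaler0 addr0 scaleN1r addNr.
  apply/eqP; apply: contraNT M0 => a0.
  by rewrite -(pmulr_lge0 _ (x := `|a|)) ?normr_gt0//; exact: le_trans (Mg a).
exists (opnorm f * complex.Re M) => a /=.
rewrite (le_trans (opnorm_ub _ _))// rmorphM/= -mulrA ler_wpM2l//.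
  by rewrite ler0c opnorm_ge0.
by rewrite RRe_real// ger0_real.
Qed.

Lemma bmul_linear_l b : linear (fun a => bmul a b).
Proof. by move=> k x y; rewrite bmulDl bmulZl. Qed.
Lemma bmul_linear_r b : linear (fun a => bmul b a).
Proof. by move=> k x y; rewrite bmulDr bmulZr. Qed.

Fact lact_subproof a f : (fun b => f (bmul b a) : R[i]^o) \in blin.
Proof.
apply: (@comp_blin (fun b => bmul b a) _ f `|a|).
  exact: bmul_linear_l.
by move=> b; rewrite mulrC ler_norm_bmul.
Qed.

Fact ract_subproof f a : (fun b => f (bmul a b) : R[i]^o) \in blin.
Proof.
apply: (@comp_blin (fun b => bmul a b) _ f `|a|).
  exact: bmul_linear_r.
by move=> b; rewrite ler_norm_bmul.
Qed.

(* <a . f, b> = <f, b a> and <f . a, b> = <f, a b> *)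
Definition lact a f : dual A := Bop (lact_subproof a f).
Definition ract f a : dual A := Bop (ract_subproof f a).

Fact ad_subproof x : (fun a => lact a x - ract x a) \in blin.
Proof.
apply/blinP; split.
  move=> k a b; apply: bop_eq => c.
  rewrite !(bopNE, bopDE, bopZE) /= bmulDr bmulZr bmulDl bmulZl !linearP/=.
  by rewrite addrACA -scalerDr.
exists (2 * opnorm x) => a; rewrite bop_normE rnormE -rmorphM lecR.
apply: opnorm_le => b b1; rewrite bopBE/= (le_trans (ler_normB _ _))//.
have H c d : `|c| <= 1 -> `|x (bmul c d)| <= (opnorm x)%:C * `|d|.
  move=> c1; rewrite (le_trans (opnorm_ub _ _))// ler_wpM2l ?ler0c ?opnorm_ge0//.
  by rewrite (le_trans (ler_norm_bmul _ _))// ler_piMl.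
have H' c d : `|c| <= 1 -> `|x (bmul d c)| <= (opnorm x)%:C * `|d|.
  move=> c1; rewrite (le_trans (opnorm_ub _ _))// ler_wpM2l ?ler0c ?opnorm_ge0//.
  by rewrite (le_trans (ler_norm_bmul _ _))// ler_piMr.
rewrite -mulrA mulr_natl mulr2n rmorphD/= rmorphM/= -rnormE.
by rewrite lerD ?H ?H'.
Qed.

Definition ad x : bop A (dual A) := Bop (ad_subproof x).

Definition derivation (D : bop A (dual A)) :=
  forall a b, D (bmul a b) = ract (D a) b + lact a (D b).

End Amenability.

Definition directed_preorder (L : Type) (le : L -> L -> Prop) :=
  [/\ inhabited L, forall l, le l l,
      forall l m n, le l m -> le m n -> le l n
    & forall l m, exists n, le l n /\ le m n].

(* A net is a map x out of a directed preorder; it converges to y when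
   x @ tails le --> y. *)
Definition tails (L : Type) (le : L -> L -> Prop) : set_system L :=
  filter_from setT (fun l => [set m | le l m]).

Definition weakstar_cvg {R : realType} {V : normedModType R[i]} (L : Type)
    (F : set_system L) (f_ : L -> dual V) (f : dual V) :=
  forall v, (fun l => f_ l v) @ F --> f v.

Definition bounded_wstar_approx_weakly_amenable {R : realType}
    (A : banachAlgType R) :=
  forall D : bop A (dual A), derivation D ->
  exists (L : Type) (le : L -> L -> Prop) (x : L -> dual A),
    [/\ directed_preorder le,
        (exists M, forall l, `|ad (x l)| <= M)
      & forall a, weakstar_cvg (tails le) (fun l => ad (x l) a) (D a)].

Section L1.
Context {R : realType}.
Variables (S : choiceType) (A : completeNormedModType R[i]).
Implicit Types (f g : S -> A).

Definition l1pred : {pred S -> A} :=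
  fun f => (\esum_(s in [set: S]) (rnorm (f s))%:E < +oo)%E.

Definition l1norm f : R := fine (\esum_(s in [set: S]) (rnorm (f s))%:E).

Lemma le_esum_seq f (r : seq S) : uniq r ->
  ((\sum_(s <- r) rnorm (f s))%:E <= \esum_(s in [set: S]) (rnorm (f s))%:E)%E.
Proof.
move=> ur; apply: esum_ge; exists [set` r]; first by split=> //; exact: finite_seq.
by rewrite -fsbig_seq// sumEFin.
Qed.

Lemma esum_le_seq f (M : R) :
  (forall r : seq S, uniq r -> \sum_(s <- r) rnorm (f s) <= M) ->
  (\esum_(s in [set: S]) (rnorm (f s))%:E <= M%:E)%E.
Proof.
move=> H; apply: ge_ereal_sup => _ [X [finX _] <-].
by rewrite fsbig_finite//= sumEFin lee_fin H// fset_uniq.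
Qed.

Lemma esum_rnormE f : f \in l1pred ->
  (\esum_(s in [set: S]) (rnorm (f s))%:E)%E = (l1norm f)%:E.
Proof.
move=> fl; rewrite fineK// ge0_fin_numE//.
by apply: esum_ge0 => s _; rewrite lee_fin rnorm_ge0.
Qed.

Lemma l1norm_seq f (r : seq S) : f \in l1pred -> uniq r ->
  \sum_(s <- r) rnorm (f s) <= l1norm f.
Proof. by move=> fl ur; rewrite -lee_fin -esum_rnormE// le_esum_seq. Qed.

Lemma l1predP f (M : R) :
  (forall r : seq S, uniq r -> \sum_(s <- r) rnorm (f s) <= M) ->
  f \in l1pred.
Proof. by move=> H; apply: le_lt_trans (esum_le_seq H) (ltry _). Qed.

Lemma l1norm_le f (M : R) :
  (forall r : seq S, uniq r -> \sum_(s <- r) rnorm (f s) <= M) ->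
  l1norm f <= M.
Proof.
by move=> H; rewrite -lee_fin -esum_rnormE ?esum_le_seq//; exact: l1predP H.
Qed.

Lemma l1norm_pt f s : f \in l1pred -> rnorm (f s) <= l1norm f.
Proof.
by move=> fl; have := l1norm_seq (r := [:: s]) fl isT; rewrite big_seq1.
Qed.

Lemma l1norm_ge0 f : 0 <= l1norm f.
Proof.
by rewrite fine_ge0// esum_ge0// => s _; rewrite lee_fin rnorm_ge0.
Qed.

Lemma l1_combine (k : R[i]) f g (r : seq S) : f \in l1pred -> g \in l1pred ->
  uniq r ->
  \sum_(s <- r) rnorm (k *: f s + g s) <= rnorm k * l1norm f + l1norm g.
Proof.
move=> fl gl ur.
apply: (@le_trans _ _ (\sum_(s <- r) (rnorm k * rnorm (f s) + rnorm (g s)))).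
  by apply: ler_sum => s _; rewrite (le_trans (rnormD _ _))// rnormZ.
rewrite big_split/= -mulr_sumr lerD ?l1norm_seq// ler_wpM2l ?rnorm_ge0//.
exact: l1norm_seq.
Qed.

Lemma l1_submod : submod_closed l1pred.
Proof.
split; last by move=> k f g fl gl; apply: l1predP => r; exact: l1_combine.
by apply: (l1predP (M := 0)) => r _; rewrite big1// => s _; rewrite rnorm0.
Qed.

HB.instance Definition _ :=
  GRing.isSubmodClosed.Build R[i] (S -> A) l1pred l1_submod.

Record l1 := L1 { l1_fun :> S -> A; l1P : l1_fun \in l1pred }.

HB.instance Definition _ := [isSub for l1_fun].
HB.instance Definition _ := [Choice of l1 by <:].
HB.instance Definition _ := [SubChoice_isSubLmodule of l1 by <:].

Lemma l1_eq (f g : l1) : f =1 g -> f = g.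
Proof. by move=> fg; apply/val_inj/funext. Qed.

Lemma l1DE (f g : l1) s : (f + g) s = f s + g s. Proof. by []. Qed.
Lemma l1BE (f g : l1) s : (f - g) s = f s - g s. Proof. by []. Qed.
Lemma l1NE (f : l1) s : (- f) s = - f s. Proof. by []. Qed.
Lemma l1ZE k (f : l1) s : (k *: f) s = k *: f s. Proof. by []. Qed.
Lemma l10E s : (0 : l1) s = 0. Proof. by []. Qed.

Lemma l1normD (f g : l1) :
  (l1norm (f + g))%:C <= (l1norm f)%:C + (l1norm g)%:C.
Proof.
rewrite -rmorphD lecR; apply: l1norm_le => r ur.
rewrite -[l1norm f]mul1r -{1}(_ : rnorm (1 : R[i]^o) = 1).
  apply: le_trans (l1_combine _ (l1P f) (l1P g) ur).
  by apply: ler_sum => s _; rewrite scale1r.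
by rewrite /rnorm normr1.
Qed.

Lemma l1normZle (k : R[i]) (f : l1) : l1norm (k *: f) <= rnorm k * l1norm f.
Proof.
apply: l1norm_le => r ur.
rewrite (eq_bigr (fun s => rnorm k * rnorm (f s))).
  by rewrite -mulr_sumr ler_wpM2l ?rnorm_ge0 ?l1norm_seq ?l1P.
by move=> s _; rewrite -rnormZ.
Qed.

Lemma l1normZ (k : R[i]) (f : l1) :
  (l1norm (k *: f))%:C = `|k| * (l1norm f)%:C.
Proof.
rewrite (rnormE k) -rmorphM; congr _%:C; apply/eqP.
rewrite eq_le l1normZle/=.
have [->|k0] := eqVneq k 0; first by rewrite rnorm0 mul0r l1norm_ge0.
have := l1normZle k^-1 (k *: f); rewrite scalerA mulVf// scale1r => le.
have rk0 : 0 < rnorm k by rewrite -ltcR -rnormE normr_gt0.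
rewrite -ler_pdivlMl//; suff <- : rnorm k^-1 = (rnorm k)^-1 by [].
by apply: complexI; rewrite -rnormE normfV rnormE fmorphV.
Qed.

Lemma l1norm_eq0 (f : l1) : (l1norm f)%:C = 0 -> f = 0.
Proof.
move=> [f0]; apply: l1_eq => s; apply: rnorm_eq0; apply/eqP.
by rewrite eq_le rnorm_ge0 -f0 l1norm_pt ?l1P.
Qed.

HB.instance Definition _ :=
  Lmodule_isNormed.Build R[i] l1 l1normD l1normZ l1norm_eq0.

Lemma l1_normE (f : l1) : `|f| = (l1norm f)%:C. Proof. by []. Qed.

Lemma l1_norm_pt (f : l1) s : `|f s| <= `|f|.
Proof. by rewrite l1_normE rnormE lecR l1norm_pt ?l1P. Qed.

Lemma l1_tail f (e : R) : f \in l1pred -> 0 < e ->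
  exists2 r0 : seq S, uniq r0 & forall r, uniq r -> {in r, forall s, s \notin r0} ->
    \sum_(s <- r) rnorm (f s) <= e.
Proof.
move=> fl e0.
have [r0 ur0 r0P] : exists2 r0, uniq r0 & l1norm f - e < \sum_(s <- r0) rnorm (f s).
  apply: contrapT => H; suff : l1norm f <= l1norm f - e.
    by rewrite lerBrDr gerDl leNgt e0.
  apply: l1norm_le => r ur; rewrite leNgt; apply/negP => lr.
  by apply: H; exists r.
exists r0 => // r ur rr0.
have : \sum_(s <- r ++ r0) rnorm (f s) <= l1norm f.
  apply: l1norm_seq => //; rewrite cat_uniq ur ur0 andbT /=.
  by apply/hasPn => s sr0; apply/negP => /rr0; rewrite sr0.
rewrite big_cat/= => le; rewrite -(lerD2r (\sum_(s <- r0) rnorm (f s))).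
by rewrite (le_trans le)// -lerBlDl ltW.
Qed.

Lemma near_seq (T : Type) (F : set_system T) (P : S -> T -> Prop) (r : seq S) :
  Filter F -> (forall s, \forall t \near F, P s t) ->
  \forall t \near F, {in r, forall s, P s t}.
Proof.
move=> FF FP; elim: r => [|s r IH]; first by apply: nearW => t s.
near=> t => u; rewrite inE => /orP[/eqP ->|]; first by near: t; exact: FP.
by move: u; near: t; exact: IH.
Unshelve. all: by end_near. Qed.

Lemma l1_complete (F : set_system l1) : ProperFilter F -> cauchy F -> cvg F.
Proof.
move=> FF /cauchyP Fc.
have Fpt s : cvg ((fun f : l1 => f s) @ F).
  apply: cauchy_cvg; apply: cauchy_exP => e e0.
  have [x0 Fx] := Fc e e0; pose x : l1 := x0; exists (x s).
  suff : F [set f : l1 | ball (x s) e (f s)] by [].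
  apply: (filterS _ Fx) => f; rewrite -!ball_normE /= => xf.
  by apply: le_lt_trans xf; exact: (l1_norm_pt (x - f) s).
pose g s := lim ((fun f : l1 => f s) @ F).
have key (e : R) (x : l1) r : 0 < e -> F (ball x e%:C) -> uniq r ->
    \sum_(s <- r) rnorm (x s - g s) <= e.
  move=> e0 Fx ur; apply/ler_addgt0Pr => d d0.
  have d'0 : 0 < d / (size r).+1%:R by rewrite divr_gt0.
  near F => f.
  have xf : `|x - f| < e%:C.
    suff : ball x e%:C f by rewrite -ball_normE.
    by near: f.
  have fg : {in r, forall s, `|g s - f s| < (d / (size r).+1%:R)%:C}.
    near: f; apply: near_seq => s.
    by apply: cvgr_dist_lt; [exact: Fpt|rewrite ltcR].
  apply: (@le_trans _ _ (\sum_(s <- r) (rnorm ((x - f) s) + rnorm (g s - f s)))).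
    apply: ler_sum => s _; rewrite -(rnormN (g s - f s)).
    rewrite -[x s - g s](subrKA (f s)) opprB l1BE; exact: rnormD.
  rewrite big_split/= lerD//.
    apply: le_trans (l1norm_seq (l1P (x - f)) ur) _.
    by rewrite -lecR ltW.
  apply: (@le_trans _ _ (\sum_(s <- r) (d / (size r).+1%:R))).
    rewrite big_seq [leRHS]big_seq; apply: ler_sum => s sr.
    by rewrite -lecR -rnormE ltW// fg.
  rewrite big_const_seq count_predT iter_addr_0 -[_ *+ size r]mulr_natr mulrAC.
  by rewrite ler_pdivrMr// ler_pM2l// ler_nat.
have gl : g \in l1pred.
  have [x Fx] := Fc 1 ltr01.
  have xg : (fun s => x s - g s) \in l1pred.
    by apply: (l1predP (M := 1)) => r; exact: key.
  suff -> : g = (x : S -> A) - (fun s => x s - g s) by rewrite rpredB ?l1P.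
  by apply/funext => s; rewrite -[RHS]/(x s - (x s - g s)) opprB addrC subrK.
apply/cvg_ex; exists (L1 gl); apply/cvgrPdist_le => e e0.
have eE : e = (complex.Re e)%:C by rewrite RRe_real// gtr0_real.
have e20 : 0 < complex.Re e / 2 by rewrite divr_gt0// -ltcR -eE.
have [|x Fx] := Fc (complex.Re e / 2)%:C; first by rewrite ltcR.
have xg : `|x - L1 gl| <= (complex.Re e / 2)%:C.
  by rewrite l1_normE lecR; apply: l1norm_le => r; exact: key.
suff : F [set f : l1 | `|L1 gl - f| <= e] by [].
apply: (filterS _ Fx) => f; rewrite -ball_normE /= => xf.
rewrite -[L1 gl - f](subrKA x) (le_trans (ler_normD _ _))// eE.
by rewrite [X in X%:C]splitr rmorphD/= lerD//; [rewrite distrC|exact: ltW].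
Unshelve. all: by end_near. Qed.

HB.instance Definition _ := Uniform_isComplete.Build l1 l1_complete.

End L1.

Arguments l1pred {R S A}.
Arguments l1 {R} S A.

#[global] Existing Instance totally_filter.

Section Sum.
Context {R : realType} {S : choiceType} {A : completeNormedModType R[i]}.
Implicit Types (f g : S -> A).

Lemma partial_sumE f (J : {fset S}) : partial_sum f J = \sum_(s <- J) f s.
Proof. by rewrite /partial_sum [RHS]big_seq_fsetE. Qed.

Lemma ler_rnorm_sum f (r : seq S) : rnorm (\sum_(s <- r) f s) <= \sum_(s <- r) rnorm (f s).
Proof.
rewrite -lecR -rnormE (le_trans (ler_norm_sum _ _ _))// rmorph_sum/=.
by apply: ler_sum => s _; rewrite rnormE.
Qed.

Lemma summable_cvg f : f \in l1pred -> cvg (partial_sum f @ totally).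
Proof.
move=> fl; apply: cauchy_cvg; apply: cauchy_exP => e e0.
have eE : e = (complex.Re e)%:C by rewrite RRe_real// gtr0_real.
have e20 : 0 < complex.Re e / 2 by rewrite divr_gt0// -ltcR -eE.
have [r0 ur0 r0P] := l1_tail fl e20.
exists (\sum_(s <- r0) f s).
exists [fset s in r0]%fset => // J /= r0J; rewrite -ball_normE /=.
rewrite distrC partial_sumE.
have -> : \sum_(s <- J) f s = \sum_(s <- r0 ++ [seq s <- J | s \notin r0]) f s.
  apply: perm_big; apply: uniq_perm.
  - exact: fset_uniq.
  - rewrite cat_uniq ur0 filter_uniq ?fset_uniq// andbT /=.
    by apply/hasPn => s; rewrite mem_filter => /andP[].
  - move=> s; rewrite mem_cat mem_filter; case: (boolP (s \in r0)) => //= sr0.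
    by apply: (fsubsetP r0J); rewrite inE.
rewrite big_cat/= [X in `|X|]addrAC subrr add0r. rewrite rnormE eE ltcR.
apply: le_lt_trans (ler_rnorm_sum _ _) _.
apply: (@le_lt_trans _ _ (complex.Re e / 2)).
  apply: r0P; first by rewrite filter_uniq ?fset_uniq.
  by move=> s; rewrite mem_filter => /andP[].
by rewrite ltr_pdivrMr// mulr_natr mulr2n ltrDl -ltcR -eE.
Qed.

Lemma sum_cvgP f : f \in l1pred -> partial_sum f @ totally --> sum f.
Proof. exact: summable_cvg. Qed.

Lemma sum_eq f v : partial_sum f @ totally --> v -> sum f = v.
Proof. by move=> /cvg_lim; apply. Qed.

Lemma sumP f g (k : R[i]) : f \in l1pred -> g \in l1pred ->
  sum (fun s => k *: f s + g s) = k *: sum f + sum g.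
Proof.
move=> fl gl; apply: sum_eq.
rewrite (_ : partial_sum _ = fun J => k *: partial_sum f J + partial_sum g J).
  by apply: cvgD; [apply: cvgZr|]; exact: sum_cvgP.
by apply/funext => J; rewrite !partial_sumE big_split/= scaler_sumr.
Qed.

Lemma rnorm_sum_le f : f \in l1pred -> rnorm (sum f) <= l1norm f.
Proof.
move=> fl; apply/ler_addgt0Pr => e e0.
near (@totally S) => J.
have H : `|sum f - partial_sum f J| < e%:C.
  by near: J; apply: cvgr_dist_lt; [exact: sum_cvgP|rewrite ltcR].
rewrite addrC -[sum f](subrK (partial_sum f J)) (le_trans (rnormD _ _))//.
rewrite lerD//; first by rewrite -lecR -rnormE ltW.
by rewrite partial_sumE (le_trans (ler_rnorm_sum _ _))// l1norm_seq// fset_uniq.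
Unshelve. all: by end_near. Qed.

Lemma sum_single f s : (forall t, t != s -> f t = 0) -> sum f = f s.
Proof.
move=> f0; apply: sum_eq; apply: cvg_near_cst.
exists [fset s]%fset => // J; rewrite /= fsub1set => sJ.
rewrite partial_sumE (big_rem s)//= big1_seq ?addr0// => t /andP[_].
by rewrite (rem_filter s (fset_uniq J)) mem_filter => /andP[ts _]; rewrite f0.
Qed.

End Sum.

Section L1Density.
Context {R : realType} {S : choiceType} {A : completeNormedModType R[i]}.

Fact l1_delta_subproof (s : S) (a : A) :
  (fun t => if t == s then a else 0) \in l1pred.
Proof.
apply: (l1predP (M := rnorm a)) => r ur.
have [sr|sr] := boolP (s \in r).
  rewrite (big_rem s)//= eqxx big1_seq ?addr0// => t /andP[_].
  by rewrite (rem_filter s ur) mem_filter => /andP[/negPf/= -> _]; rewrite rnorm0.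
rewrite big1_seq ?rnorm_ge0// => t /andP[_ tr].
by case: eqP tr sr => [-> ->|]; rewrite ?rnorm0.
Qed.

Definition l1_delta s a : l1 S A := L1 (l1_delta_subproof s a).

Lemma l1_ext (V : normedZmodType R[i]) (phi : l1 S A -> V) (M : R) :
  {morph phi : x y / x + y} -> (forall x, `|phi x| <= M%:C * `|x|) ->
  (forall s a, phi (l1_delta s a) = 0) -> forall x, phi x = 0.
Proof.
move=> phiD phiM phi0 x.
have p0 : phi 0 = 0 by apply/(addrI (phi 0)); rewrite -phiD !addr0.
apply: rnorm_eq0; apply/eqP; rewrite eq_le rnorm_ge0 andbT.
apply/ler_addgt0Pr => e e0; rewrite add0r.
have M1 : 0 < `|M| + 1 by rewrite ltr_wpDl.
have d0 : 0 < e / (`|M| + 1) by rewrite divr_gt0.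
have [r0 ur0 r0P] := l1_tail (l1P x) d0.
pose y := \sum_(s <- r0) l1_delta s (x s).
have phiy : phi y = 0.
  rewrite /y; elim: (r0) => [|s r IH]; first by rewrite big_nil.
  by rewrite big_cons phiD phi0 IH addr0.
have yE t : y t = if t \in r0 then x t else 0.
  rewrite /y; elim: (r0) ur0 => [_|s r IH /= /andP[sr ur]]; first by rewrite big_nil.
  rewrite big_cons l1DE IH// inE /=.
  by case: eqP => [->|]; rewrite ?(negPf sr) ?addr0 ?add0r.
have [z zx] : exists z : l1 S A, x = z + y by exists (x - y); rewrite subrK.
have zE s : z s = if s \in r0 then 0 else x s.
  have : x s = z s + y s by rewrite {1}zx.
  rewrite yE; case: ifP => _ xs; last by rewrite xs addr0.
  by apply: (addIr (x s)); rewrite -xs add0r.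
have zN : l1norm z <= e / (`|M| + 1).
  apply: l1norm_le => r ur.
  rewrite (bigID (fun s => s \in r0))/= big1 ?add0r; last first.
    by move=> s sr; rewrite zE sr rnorm0.
  rewrite (eq_bigr (fun s => rnorm (x s))) => [|s /negPf sr]; last by rewrite zE sr.
  rewrite -big_filter; apply: r0P; first by rewrite filter_uniq.
  by move=> s; rewrite mem_filter => /andP[].
have -> : phi x = phi z by rewrite [in LHS]zx phiD phiy addr0.
have := phiM z; rewrite l1_normE rnormE -rmorphM lecR => /le_trans; apply.
apply: (@le_trans _ _ ((`|M| + 1) * l1norm z)).
  by rewrite ler_wpM2r ?l1norm_ge0// (le_trans (ler_norm M))// lerDl.
by rewrite mulrC -ler_pdivlMr.
Qed.

End L1Density.

Section PairSum.
Context {R : realType}.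

Lemma ler_sum_subseq (S : eqType) (u : S -> R) (r r' : seq S) :
  uniq r -> uniq r' -> {subset r <= r'} -> (forall s, 0 <= u s) ->
  \sum_(s <- r) u s <= \sum_(s <- r') u s.
Proof.
move=> ur ur' rr' u0; rewrite [leRHS](bigID (fun s => s \in r))/=.
suff <- : \sum_(s <- r) u s = \sum_(s <- r' | s \in r) u s.
  by rewrite lerDl sumr_ge0.
rewrite -[RHS]big_filter; apply: perm_big; apply: uniq_perm => //.
  by rewrite filter_uniq.
by move=> s; rewrite mem_filter; case: (boolP (s \in r)) => // /rr'.
Qed.

Lemma pair_sum_le (S T : eqType) (u : S -> R) (v : T -> R) (U V : R)
    (Q : eqType) (h : Q -> S * T) (r : seq Q) :
  (forall s, 0 <= u s) -> (forall t, 0 <= v t) ->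
  (forall r, uniq r -> \sum_(s <- r) u s <= U) ->
  (forall r, uniq r -> \sum_(t <- r) v t <= V) ->
  injective h -> uniq r ->
  \sum_(q <- r) u (h q).1 * v (h q).2 <= U * V.
Proof.
move=> u0 v0 uU vV hI ur.
rewrite -(big_map h xpredT (fun p => u p.1 * v p.2)).
set r1 := undup (map fst (map h r)); set r2 := undup (map snd (map h r)).
apply: (@le_trans _ _ (\sum_(p <- [seq (s, t) | s <- r1, t <- r2]) u p.1 * v p.2)).
  apply: ler_sum_subseq.
  - by rewrite map_inj_uniq.
  - by rewrite allpairs_uniq ?undup_uniq// => -[? ?] [? ?].
  - move=> [s t] st; apply/allpairsP; exists (s, t); split=> //=.
      by rewrite mem_undup; apply/mapP; exists (s, t).
    by rewrite mem_undup; apply/mapP; exists (s, t).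
  - by move=> p; rewrite mulr_ge0.
rewrite big_allpairs/=.
under eq_bigr do rewrite -mulr_sumr.
rewrite -mulr_suml ler_pM ?sumr_ge0 ?uU ?vV ?undup_uniq//.
Qed.

Lemma sum_l1norm_le (S T : choiceType) (A : completeNormedModType R[i])
    (h : S -> T -> A) (r : seq S) (M : R) :
  (forall s, h s \in l1pred) ->
  (forall r', uniq r' -> \sum_(s <- r) \sum_(t <- r') rnorm (h s t) <= M) ->
  \sum_(s <- r) l1norm (h s) <= M.
Proof.
move=> hl hM; rewrite -lee_fin -sumEFin.
under eq_bigr do rewrite -esum_rnormE//.
rewrite -esum_sum; last by move=> t s _ _; rewrite lee_fin rnorm_ge0.
apply: ge_ereal_sup => _ [X [finX _] <-].
rewrite fsbig_finite//=.
under eq_bigr do rewrite sumEFin.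
by rewrite sumEFin lee_fin exchange_big/= hM// fset_uniq.
Qed.

End PairSum.

Section Munn.
Context {R : realType}.
Variables (A : banachAlgType R) (I J : choiceType) (P : J -> I -> A).

Definition mx_supnorm : \bar R :=
  ereal_sup [set (rnorm (P ji.1 ji.2))%:E | ji in [set: J * I]].

(* The underlying Banach space does not depend on P; the multiplication does.
   The bound on P is a parameter because the l^1 norm is submultiplicative
   only thanks to it. *)
Definition LM & (mx_supnorm <= 1)%E : Type := l1 (I * J)%type A.

Hypothesis P1 : (mx_supnorm <= 1)%E.

Lemma rnormP1 j i : rnorm (P j i) <= 1.
Proof.
rewrite -lee_fin; apply: le_trans P1; apply: ereal_sup_ubound.
by exists (j, i).
Qed.

Lemma rnorm_bmul (a b : A) : rnorm (bmul a b) <= rnorm a * rnorm b.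
Proof. by rewrite -lecR rmorphM/= -!rnormE ler_norm_bmul. Qed.

Definition munn_term (X Y : l1 (I * J)%type A) (ij : I * J) (kl : J * I) : A :=
  bmul (bmul (X (ij.1, kl.1)) (P kl.1 kl.2)) (Y (kl.2, ij.2)).

Lemma munn_term_le X Y ij kl : rnorm (munn_term X Y ij kl) <=
  rnorm (X (ij.1, kl.1)) * rnorm (Y (kl.2, ij.2)).
Proof.
rewrite (le_trans (rnorm_bmul _ _))// ler_wpM2r ?rnorm_ge0//.
by rewrite (le_trans (rnorm_bmul _ _))// ler_piMr ?rnorm_ge0 ?rnormP1.
Qed.

Lemma munn_term_sum (Q : eqType) (h : Q -> (I * J) * (J * I)) (r : seq Q) X Y :
  injective h -> uniq r ->
  \sum_(q <- r) rnorm (munn_term X Y (h q).1 (h q).2) <= l1norm X * l1norm Y.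
Proof.
move=> hI ur.
pose sw (q : Q) := (((h q).1.1, (h q).2.1), ((h q).2.2, (h q).1.2)).
apply: (@le_trans _ _ (\sum_(q <- r) rnorm (X (sw q).1) * rnorm (Y (sw q).2))).
  by apply: ler_sum => q _; exact: munn_term_le.
apply: (pair_sum_le (u := fun s => rnorm (X s)) (v := fun s => rnorm (Y s))) => //.
- by move=> s; exact: rnorm_ge0.
- by move=> s; exact: rnorm_ge0.
- by move=> r' ur'; rewrite l1norm_seq ?l1P.
- by move=> r' ur'; rewrite l1norm_seq ?l1P.
- move=> p q; rewrite /sw => -[e1 e2 e3 e4]; apply: hI.
  by case: (h p) (h q) e1 e2 e3 e4 => [[? ?] [? ?]] [[? ?] [? ?]] /= -> -> -> ->.
Qed.

Lemma munn_term_l1 X Y ij : munn_term X Y ij \in l1pred.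
Proof.
apply: (l1predP (M := l1norm X * l1norm Y)) => r ur.
by apply: (munn_term_sum (h := fun kl => (ij, kl))) => // ? ? [].
Qed.

(* (X P Y)_ij, as an unordered sum over the finite subsets of J * I. *)
Definition munn_mul_fun (X Y : l1 (I * J)%type A) (ij : I * J) : A :=
  sum (fun kl : J * I =>
    bmul (bmul (X (ij.1, kl.1)) (P kl.1 kl.2)) (Y (kl.2, ij.2))).

Lemma munn_mul_seq X Y (r : seq (I * J)) : uniq r ->
  \sum_(ij <- r) rnorm (munn_mul_fun X Y ij) <= l1norm X * l1norm Y.
Proof.
move=> ur; apply: (@le_trans _ _ (\sum_(ij <- r) l1norm (munn_term X Y ij))).
  by apply: ler_sum => ij _; apply: rnorm_sum_le; exact: munn_term_l1.
apply: sum_l1norm_le => [ij|r' ur']; first exact: munn_term_l1.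
have := big_allpairs (op := +%R) (F := fun p => rnorm (munn_term X Y p.1 p.2)) (r1 := r) (r2 := r').
move=> /= <-.
apply: (munn_term_sum (h := id)) => //.
by rewrite allpairs_uniq// => -[? ?] [? ?].
Qed.

Lemma munn_mul_subproof X Y : munn_mul_fun X Y \in l1pred.
Proof. exact: l1predP (@munn_mul_seq X Y). Qed.

Definition munn_mul X Y : l1 (I * J)%type A := L1 (munn_mul_subproof X Y).

Lemma munn_mul_norm X Y : `|munn_mul X Y| <= `|X| * `|Y|.
Proof.
rewrite !l1_normE -rmorphM lecR; apply: l1norm_le => r; exact: munn_mul_seq.
Qed.

Lemma munn_linear_l Y k X X' :
  munn_mul (k *: X + X') Y = k *: munn_mul X Y + munn_mul X' Y.
Proof.
apply: l1_eq => ij; rewrite l1DE l1ZE /= /munn_mul_fun.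
rewrite -(sumP _ (munn_term_l1 X Y ij) (munn_term_l1 X' Y ij)).
congr sum; apply/funext => kl.
by rewrite l1DE l1ZE !bmulDl !bmulZl.
Qed.

Lemma munn_linear_r Y k X X' :
  munn_mul Y (k *: X + X') = k *: munn_mul Y X + munn_mul Y X'.
Proof.
apply: l1_eq => ij; rewrite l1DE l1ZE /= /munn_mul_fun.
rewrite -(sumP _ (munn_term_l1 Y X ij) (munn_term_l1 Y X' ij)).
congr sum; apply/funext => kl.
by rewrite l1DE l1ZE !bmulDr !bmulZr.
Qed.

Lemma munnDl : left_distributive munn_mul +%R.
Proof.
by move=> X Y Z; have := munn_linear_l Z 1 X Y; rewrite !scale1r.
Qed.

Lemma munnDr : right_distributive munn_mul +%R.
Proof.
by move=> X Y Z; have := munn_linear_r X 1 Y Z; rewrite !scale1r.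
Qed.

Lemma munn0l Y : munn_mul 0 Y = 0.
Proof. by apply: (addrI (munn_mul 0 Y)); rewrite -munnDl !addr0. Qed.

Lemma munn0r Y : munn_mul Y 0 = 0.
Proof. by apply: (addrI (munn_mul Y 0)); rewrite -munnDr !addr0. Qed.

Lemma munnZl (k : R[i]) X Y : munn_mul (k *: X) Y = k *: munn_mul X Y.
Proof. by have := munn_linear_l Y k X 0; rewrite munn0l !addr0. Qed.

Lemma munnZr (k : R[i]) X Y : munn_mul X (k *: Y) = k *: munn_mul X Y.
Proof. by have := munn_linear_r X k Y 0; rewrite munn0r !addr0. Qed.

Lemma bmul0l (B : banachAlgType R) (a : B) : bmul 0 a = 0.
Proof. by apply: (addrI (bmul 0 a)); rewrite -bmulDl !addr0. Qed.

Lemma bmul0r (B : banachAlgType R) (a : B) : bmul a 0 = 0.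
Proof. by apply: (addrI (bmul a 0)); rewrite -bmulDr !addr0. Qed.

Lemma munn_delta i k l j a b :
  munn_mul (l1_delta (i, k) a) (l1_delta (l, j) b) =
  l1_delta (i, j) (bmul (bmul a (P k l)) b).
Proof.
apply: l1_eq => -[i' j'] /=; rewrite /munn_mul_fun /=.
rewrite (sum_single (s := (k, l))) /=; last first.
  move=> [k' l'] kl; rewrite !xpair_eqE.
  have [k'k|] := eqVneq k' k; last by rewrite andbF !bmul0l.
  have [l'l|] := eqVneq l' l; last by rewrite andFb bmul0r.
  by move: kl; rewrite k'k l'l eqxx.
rewrite !xpair_eqE !eqxx andbT /=.
by case: (i' == i); case: (j' == j) => /=; rewrite ?bmul0l ?bmul0r ?bmul0l.
Qed.

Lemma munnA : associative munn_mul.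
Proof.
pose T X Y Z := munn_mul X (munn_mul Y Z) - munn_mul (munn_mul X Y) Z.
suff T0 X Y Z : T X Y Z = 0 by move=> X Y Z; apply/eqP; rewrite -subr_eq0 [X in X == _]T0.
have TM X' Y' Z' : `|T X' Y' Z'| <= 2 * (`|X'| * `|Y'| * `|Z'|).
  rewrite mulr_natl mulr2n (le_trans (ler_normB _ _))// lerD//.
    by rewrite -mulrA (le_trans (munn_mul_norm _ _))// ler_wpM2l// munn_mul_norm.
  by rewrite (le_trans (munn_mul_norm _ _))// ler_wpM2r// munn_mul_norm.
move: X; apply: (l1_ext (phi := fun X => T X Y Z) (M := 2 * (l1norm Y * l1norm Z))).
- by move=> X X'; rewrite /T !munnDl opprD addrACA.
- move=> X; rewrite (le_trans (TM _ _ _))// !rmorphM/= !l1_normE.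
  by rewrite -(mulrA (l1norm X)%:C) (mulrC (l1norm X)%:C) rmorph_nat -[leRHS]mulrA.
move=> [i k] a.
move: Y; apply: (l1_ext (phi := fun Y => T _ Y Z)
  (M := 2 * (l1norm (l1_delta (i, k) a) * l1norm Z))).
- by move=> Y Y'; rewrite /T !(munnDl, munnDr) opprD addrACA.
- move=> Y; rewrite (le_trans (TM _ _ _))// !rmorphM/= !l1_normE.
  by rewrite (mulrAC _ (l1norm Y)%:C) rmorph_nat -[leRHS]mulrA.
move=> [l j] b.
move: Z; apply: (l1_ext (phi := fun Z => T _ _ Z)
  (M := 2 * (l1norm (l1_delta (i, k) a) * l1norm (l1_delta (l, j) b)))).
- by move=> Z Z'; rewrite /T !munnDr opprD addrACA.
- move=> Z; rewrite (le_trans (TM _ _ _))// !rmorphM/= !l1_normE.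
  by rewrite rmorph_nat -[leRHS]mulrA.
by move=> [m n] c; rewrite /T !munn_delta !bmulA subrr.
Qed.

HB.instance Definition _ := CompleteNormedModule.copy (LM P1) (l1 (I * J)%type A).
HB.instance Definition _ := CompleteNormedModule_isBanachAlgebra.Build R (LM P1)
  munnA munnDl munnDr munnZl munnZr munn_mul_norm.

End Munn.

Arguments mx_supnorm {R A I J} P.
Arguments LM {R A I J} P _.

(* Main.v *)
Require Import Defs.
From mathcomp Require Import all_boot all_order all_algebra finmap complex.
From mathcomp Require Import all_classical all_reals.
From mathcomp Require Import ereal topology normedtype.
From mathcomp Require Import showcase.summability.
From mathcomp Require Import ring.

Set Implicit Arguments.
Unset Strict Implicit.
Unset Printing Implicit Defensive.

Import Order.TTheory GRing.Theory Num.Theory.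
Import numFieldNormedType.Exports.
Local Open Scope classical_set_scope.
Local Open Scope ring_scope.
Local Open Scope complex_scope.

(** Fix an invertible entry p of P, at position (j0, i0), with inverse q, and
write a e_ij for the matrix whose only nonzero entry is a, at (i, j), so that
a e_ij o b e_kl = a P_jk b e_il.

Then a |-> a q e_(i0 j0) is a multiplicative embedding of A into LM(A, P), so a
derivation D of LM(A, P) restricts to a derivation D0 of A, and the hypothesis
yields a net (x_l) with (ad x_l) bounded and tending to D0.  The factorisation
a e_ij = q e_(i j0) o a q e_(i0 j0) o e_(i0 j) and the Leibniz rule express D
through D0 and the functionals g_kj (c) = D(e_(i0 j))(c q e_(k j0)):

  D(a e_ij)(b e_kl) = D0(P_li a)(P_jk b) + g_kj(b P_li a) - g_il(a P_jk b)

([munn_derivationE]).  The last two terms are those of ad_g (a e_ij)(b e_kl),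
where g is the functional with entry g_kj at (k, j).  Likewise, the functional
x with entry c |-> x_l(P_jk c) at (k, j) satisfies
ad_x (a e_ij)(b e_kl) = ad_(x_l) (P_li a)(P_jk b).  So y_l = x + g satisfies

  (ad_(y_l) - D)(a e_ij)(b e_kl) = (ad_(x_l) - D0)(P_li a)(P_jk b)

([munn_ad_lift]).  As the entries of P have norm at most 1, the right-hand side
is bounded uniformly in l by a multiple of the product of the norms of a and b,
and it tends to 0.  Both facts pass from the matrices with one entry to all of
LM(A, P), because the former span a dense subspace of l^1: this is
[munn_bop_norm_le] and [munn_weakstar_cvg0].

If J x I is empty, LM(A, P) is zero and the zero net does. *)

(** * Duality on l^1 *)

Section L1Duality.
Context {R : realType} {S : choiceType} {A : completeNormedModType R[i]}.

Lemma l1_deltaE (s : S) (a : A) : l1_delta s a s = a.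
Proof. by rewrite /= eqxx. Qed.

Lemma l1_delta_linear (s : S) : linear (l1_delta s : A -> l1 S A).
Proof.
move=> k a b; apply: l1_eq => t; rewrite l1DE l1ZE /=.
by case: eqP => _ //; rewrite scaler0 addr0.
Qed.

Lemma l1_delta_norm (s : S) (a : A) : `|l1_delta s a| = `|a|.
Proof.
apply/le_anti/andP; split; last first.
  by rewrite -[in leLHS](l1_deltaE s a) l1_norm_pt.
rewrite l1_normE rnormE lecR; apply: l1norm_le => r ur.
have [sr|sr] := boolP (s \in r).
  rewrite (big_rem s)//= eqxx big1_seq ?addr0// => t /andP[_].
  rewrite (rem_filter s ur) mem_filter => /andP[/= /negPf -> _].
  by rewrite rnorm0.
rewrite big1_seq ?rnorm_ge0// => t /andP[_ tr] /=.
by case: eqP tr sr => [-> ->|]; rewrite ?rnorm0.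
Qed.

(** The tails of an absolutely summable family are small, so its finite
    truncations approximate it. *)
Lemma l1_dense (f : l1 S A) (e : R) : 0 < e ->
  exists2 r, uniq r & `|f - \sum_(s <- r) l1_delta s (f s)| <= e%:C.
Proof.
move=> e0; have [r ur rP] := l1_tail (l1P f) e0; exists r => //.
have E t : (f - \sum_(s <- r) l1_delta s (f s)) t = if t \in r then 0 else f t.
  have -> : (f - \sum_(s <- r) l1_delta s (f s)) t =
      f t - (\sum_(s <- r) l1_delta s (f s) : l1 S A) t by [].
  have -> : (\sum_(s <- r) l1_delta s (f s) : l1 S A) t =
      \sum_(s <- r) l1_delta s (f s) t.
    by elim/big_rec2: _ => // s y z _ <-.
  case: ifPn => tr; last first.
    rewrite big1_seq ?subr0// => s /andP[_ sr] /=.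
    by have [ts|//] := eqVneq t s; rewrite ts sr in tr.
  rewrite (big_rem t)//= eqxx big1_seq ?addr0 ?subrr// => s /andP[_].
  by rewrite (rem_filter t ur) mem_filter eq_sym => /andP[/= /negPf ->].
rewrite l1_normE lecR; apply: l1norm_le => r' ur'.
under eq_bigr do rewrite E.
rewrite (bigID (fun s => s \in r))/= big1 ?add0r; last first.
  by move=> s ->; rewrite rnorm0.
under eq_bigr do rewrite ifN//.
rewrite -big_filter; apply: rP; first by rewrite filter_uniq.
by move=> s; rewrite mem_filter => /andP[].
Qed.

(** The scaling by M, whose sign is free, is the form in which density meets a
    bounded map of bound M. *)
Lemma l1_approx (f : l1 S A) (M e : R) : 0 < e ->
  exists2 r, uniq r & M%:C * `|f - \sum_(s <- r) l1_delta s (f s)| <= e%:C.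
Proof.
move=> e0; have M0 : 0 < `|M| + 1 by rewrite ltr_wpDl.
have [|r ur rP] := l1_dense f (e := e / (`|M| + 1)); first exact: divr_gt0.
exists r => //; apply: le_trans (_ : (`|M| + 1)%:C * (e / (`|M| + 1))%:C <= _).
  rewrite (le_trans (ler_wpM2r _ (_ : _ <= (`|M| + 1)%:C)))//.
    by rewrite lecR (le_trans (ler_norm M))// lerDl.
  by rewrite ler_wpM2l// ler0c ltW.
by rewrite -rmorphM lecR mulrC divfK// gt_eqF.
Qed.

(** On a finite truncation of f, the triangle inequality gives the bound
    M * (the norm of f); the truncations are dense. *)
Lemma l1_bop_norm_le (V : normedModType R[i]) (T : bop (l1 S A) V) (M : R) :
  0 <= M -> (forall s a, `|T (l1_delta s a)| <= M%:C * `|a|) -> `|T| <= M%:C.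
Proof.
move=> M0 TM; rewrite bop_normE lecR; apply: opnorm_le => f f1.
rewrite rnormE lecR; apply/ler_addgt0Pr => e e0.
have [r ur rP] := l1_approx f (opnorm T) e0.
rewrite -lecR -rnormE -[f](subrK (\sum_(s <- r) l1_delta s (f s))) addrC.
rewrite linearD (le_trans (ler_normD _ _))// rmorphD/= lerD//; last first.
  exact: le_trans (opnorm_ub _ _) rP.
rewrite linear_sum/= (le_trans (ler_norm_sum _ _ _))//.
apply: (@le_trans _ _ (\sum_(s <- r) M%:C * `|f s|)).
  by apply: ler_sum => s _.
rewrite -mulr_sumr -[leRHS]mulr1 ler_wpM2l ?ler0c//.
apply: le_trans f1; rewrite l1_normE.
under eq_bigr do rewrite rnormE.
by rewrite -rmorph_sum lecR l1norm_seq ?l1P.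
Qed.

(** The usual argument for a uniformly bounded net converging on a total set.
    The maps are functions rather than elements of [bop] so that the lemma also
    applies to a bounded bilinear map with its second argument fixed. *)
Lemma l1_bounded_cvg0 (V : normedModType R[i]) (L : Type) (F : set_system L)
    (phi : L -> l1 S A -> V) (M : R) :
  Filter F -> (forall l, {morph phi l : f g / f + g}) ->
  (forall l f, `|phi l f| <= M%:C * `|f|) ->
  (forall s a, phi ^~ (l1_delta s a) @ F --> (0 : V)) ->
  forall f, phi ^~ f @ F --> (0 : V).
Proof.
move=> FF phiD phiM phi0 f; apply/cvgr0Pnorm_le => e e0.
have eE : e = (complex.Re e)%:C by rewrite RRe_real// gtr0_real.
have e20 : 0 < complex.Re e / 2 by rewrite divr_gt0// -ltcR -eE.
have [r ur rP] := l1_approx f M e20.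
have phisum l : phi l (\sum_(s <- r) l1_delta s (f s)) =
    \sum_(s <- r) phi l (l1_delta s (f s)).
  apply: (big_morph _ (phiD l)); apply/eqP.
  by rewrite -normr_le0 (le_trans (phiM l 0))// normr0 mulr0.
have sum0 : (fun l => \sum_(s <- r) phi l (l1_delta s (f s))) @ F --> (0 : V).
  elim: (r) => [|s r' IH].
    by under eq_fun do rewrite big_nil; exact: cvg_cst.
  under eq_fun do rewrite big_cons.
  by rewrite -[0 as X in nbhs X]addr0; apply: cvgD; [exact: phi0|exact: IH].
near=> l.
rewrite -[f](subrK (\sum_(s <- r) l1_delta s (f s))) phiD.
rewrite (le_trans (ler_normD _ _))// eE [X in X%:C]splitr rmorphD/= lerD//.
  exact: le_trans (phiM _ _) rP.
rewrite phisum; near: l.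
by move/cvgr0Pnorm_le: sum0; apply; rewrite ltcR.
Unshelve. all: by end_near. Qed.

(** The functional sends f to the sum of the x_s (f_s).  To sum in the Banach
    space A instead of the scalars, pick s0 and b with x_s0(b) != 0, sum the
    vectors x_s (f_s) b in A, apply x_s0 to the result and divide by x_s0(b);
    if no such pair exists, the zero functional does. *)
Lemma l1_functional (x : S -> dual A) (M : R) : (forall s, `|x s| <= M%:C) ->
  exists f : dual (l1 S A), forall s a, f (l1_delta s a) = x s a.
Proof.
move=> xM.
have [[s0 [b xb]]|x0] := pselect (exists s b, x s b != 0); last first.
  exists 0 => s a; rewrite bop0E; apply: contrapT => xsa.
  by apply: x0; exists s, a; apply/eqP => xsa0; rewrite xsa0 in xsa.
have M0 : 0 <= M.
  by rewrite -ler0c (le_trans _ (xM s0)).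
pose h (f : l1 S A) s : A := x s (f s) *: b.
have h_le (f : l1 S A) s : rnorm (h f s) <= M * rnorm b * rnorm (f s).
  rewrite /h rnormZ mulrAC ler_wpM2r ?rnorm_ge0// -lecR rmorphM/= -!rnormE.
  by apply: le_trans (opnorm_ub (x s) (f s)) _; rewrite ler_wpM2r// -bop_normE.
have h_seq (f : l1 S A) r : uniq r ->
    \sum_(s <- r) rnorm (h f s) <= M * rnorm b * l1norm f.
  move=> ur; apply: (@le_trans _ _ (\sum_(s <- r) M * rnorm b * rnorm (f s))).
    by apply: ler_sum => s _.
  by rewrite -mulr_sumr ler_wpM2l ?mulr_ge0 ?rnorm_ge0 ?l1norm_seq ?l1P.
have hl1 (f : l1 S A) : h f \in l1pred by apply: l1predP => r; exact: h_seq.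
pose F (f : l1 S A) : R[i]^o := (x s0 b)^-1 *: x s0 (sum (h f)).
have FP : F \in blin.
  apply/blinP; split=> [k f g|].
    rewrite /F; have -> : h (k *: f + g) = fun s => k *: h f s + h g s.
      apply/funext => s; rewrite /h l1DE l1ZE linearP/= scalerDl.
      by rewrite -scalerA.
    by rewrite sumP// linearP/= scalerDr !scalerA [_ * k]mulrC.
  exists (rnorm (x s0 b)^-1 * (opnorm (x s0) * (M * rnorm b))) => f.
  rewrite normrZ rmorphM/= -rnormE -mulrA ler_wpM2l//.
  rewrite (le_trans (opnorm_ub _ _))// rmorphM/= -mulrA ler_wpM2l//.
    by rewrite ler0c opnorm_ge0.
  rewrite l1_normE -rmorphM rnormE lecR (le_trans (rnorm_sum_le (hl1 f)))//.
  by apply: l1norm_le => r; exact: h_seq.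
exists (Bop FP) => s a; rewrite /= /F (sum_single (s := s)).
  rewrite /h l1_deltaE linearZ/= scalerA mulrC -scalerA.
  by rewrite [_ *: x s0 b]mulVf// [LHS]mulr1.
by move=> t /negPf ts; rewrite /h /= ts linear0 scale0r.
Qed.

End L1Duality.

(** * Bounded maps and derivations *)

Section BoundedMaps.
Context {R : realType}.

Fact bcomp_subproof (U V W : normedModType R[i]) (g : bop V W) (f : bop U V) :
  (fun u => g (f u)) \in blin.
Proof.
apply/blinP; split=> [k u v|]; first by rewrite !linearP.
exists (opnorm g * opnorm f) => u.
rewrite (le_trans (opnorm_ub _ _))// rmorphM/= -mulrA ler_wpM2l ?opnorm_ub//.
by rewrite ler0c opnorm_ge0.
Qed.

Definition bcomp (U V W : normedModType R[i]) (g : bop V W) (f : bop U V) :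
  bop U W := Bop (bcomp_subproof g f).

Lemma bop_norm_le (V W : normedModType R[i]) (f : bop V W) (M : R) :
  0 <= M -> (forall v, `|f v| <= M%:C * `|v|) -> `|f| <= M%:C.
Proof.
move=> M0 fM; rewrite bop_normE lecR; apply: opnorm_le => v v1.
by rewrite (le_trans (fM v))// ler_piMr// ler0c.
Qed.

Fact bpullback_subproof (V W : normedModType R[i]) (D : bop W (dual W))
    (phi : bop V W) : (fun v => bcomp (D (phi v)) phi) \in blin.
Proof.
apply/blinP; split=> [k u v|].
  by apply: bop_eq => w; rewrite bopDE bopZE /= !linearP bopDE bopZE.
exists (opnorm D * opnorm phi * opnorm phi) => v.
rewrite (rnormE v) -rmorphM; apply: bop_norm_le => [|w].
  by rewrite !mulr_ge0 ?opnorm_ge0 ?rnorm_ge0.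
rewrite (le_trans (opnorm_ub (D (phi v)) (phi w)))// -bop_normE.
rewrite [X in _ <= X%:C * _]mulrAC rmorphM -mulrA ler_pM ?opnorm_ub//.
rewrite (le_trans (opnorm_ub D (phi v)))// -mulrA rmorphM ler_wpM2l//.
  by rewrite ler0c opnorm_ge0.
by rewrite rmorphM/= -rnormE opnorm_ub.
Qed.

Definition bpullback (V W : normedModType R[i]) (D : bop W (dual W))
  (phi : bop V W) : bop V (dual V) := Bop (bpullback_subproof D phi).

Lemma derivationE (B : banachAlgType R) (D : bop B (dual B)) :
  derivation D ->
  forall a b c, D (bmul a b) c = D a (bmul b c) + D b (bmul c a).
Proof. by move=> dD a b c; rewrite dD. Qed.

(** The Leibniz rule for D at phi(a), phi(b), tested against the range of phi
    only, is the Leibniz rule on B. *)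
Lemma derivation_bpullback (B C : banachAlgType R) (phi : bop B C)
    (D : bop C (dual C)) :
  {morph phi : a b / bmul a b} -> derivation D -> derivation (bpullback D phi).
Proof.
move=> phiM dD a b; apply: bop_eq => c.
by rewrite bopDE /= !phiM (derivationE dD).
Qed.

Lemma ad_subE (B : banachAlgType R) (x : dual B) (D : bop B (dual B))
    (a b : B) :
  (ad x - D) a b = x (bmul b a) - x (bmul a b) - D a b.
Proof. by rewrite !bopBE. Qed.

Lemma weakstar_cvg_sub0 (V W : normedModType R[i]) (L : Type) (F : set_system L)
    (T : L -> bop W (dual V)) (D : bop W (dual V)) : Filter F ->
  (forall w, weakstar_cvg F (fun l => T l w) (D w)) <->
  (forall w v, (fun l => (T l - D) w v) @ F --> (0 : R[i]^o)).
Proof.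
move=> FF; have subE w v :
    (fun l => (T l - D) w v) = (fun l => T l w v - D w v).
  by apply/funext => l; rewrite !bopBE.
split=> TD w v.
  by rewrite subE; apply: (subr_cvg0 (V := R[i]^o) _ _).2; exact: TD.
by apply: (subr_cvg0 (V := R[i]^o) _ _).1; rewrite -subE; exact: TD.
Qed.

End BoundedMaps.

(** * Matrices with one entry *)

Section MunnUnits.
Context {R : realType} {A : banachAlgType R} {I J : choiceType}.
Context {P : J -> I -> A} {P1 : (mx_supnorm P <= 1)%E}.

Lemma munn_entry_contraction j i a : `|bmul (P j i) a| <= `|a|.
Proof.
rewrite !rnormE lecR (le_trans (rnorm_bmul _ _))//.
by rewrite ler_piMl ?rnorm_ge0 ?rnormP1.
Qed.

Definition munn_unit (i : I) (j : J) (a : A) : LM P P1 := l1_delta (i, j) a.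

Lemma munn_unitM i k l j a b :
  bmul (munn_unit i k a) (munn_unit l j b) =
  munn_unit i j (bmul (bmul a (P k l)) b).
Proof. exact: munn_delta. Qed.

Fact munn_corner_subproof i j (q : A) :
  (fun a => munn_unit i j (bmul a q)) \in blin.
Proof.
apply/blinP; split=> [k a b|].
  by rewrite bmulDl bmulZl /munn_unit l1_delta_linear.
exists (rnorm q) => a; rewrite -rnormE mulrC [leLHS]l1_delta_norm.
exact: ler_norm_bmul.
Qed.

Definition munn_corner i j q : bop A (LM P P1) :=
  Bop (munn_corner_subproof i j q).

(** [l1_bop_norm_le] in each of the two arguments. *)
Lemma munn_bop_norm_le (T : bop (LM P P1) (dual (LM P P1))) (M : R) :
  0 <= M ->
  (forall i j k l a b,
    `|T (munn_unit i j a) (munn_unit k l b)| <= M%:C * `|a| * `|b|) ->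
  `|T| <= M%:C.
Proof.
move=> M0 TM; apply: l1_bop_norm_le => // -[i j] a.
rewrite (rnormE a) -rmorphM; apply: l1_bop_norm_le => [|[k l] b].
  by rewrite mulr_ge0 ?rnorm_ge0.
by rewrite rmorphM/= -rnormE TM.
Qed.

(** [l1_bounded_cvg0] in each of the two arguments. *)
Lemma munn_weakstar_cvg0 (L : Type) (F : set_system L)
    (T : L -> bop (LM P P1) (dual (LM P P1))) (M : R) :
  Filter F -> (forall l, `|T l| <= M%:C) ->
  (forall i j k m a b,
    (fun l => T l (munn_unit i j a) (munn_unit k m b)) @ F --> (0 : R[i]^o)) ->
  forall X Y, (fun l => T l X Y) @ F --> (0 : R[i]^o).
Proof.
move=> FF TM T0 X Y.
have TXY l X' Y' : `|T l X' Y'| <= M%:C * `|X'| * `|Y'|.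
  rewrite (le_trans (opnorm_ub _ _))// ler_wpM2r// -bop_normE.
  by rewrite (le_trans (opnorm_ub _ _))// ler_wpM2r// -bop_normE.
move: X; apply: (l1_bounded_cvg0 (M := M * l1norm Y)) => [l X X'|l X|[i j] a].
- by rewrite linearD.
- by rewrite rmorphM/= mulrAC -l1_normE TXY.
move: Y; apply: (l1_bounded_cvg0 (M := M * rnorm a)) => [l Y Y'|l Y|[k m] b].
- by rewrite linearD.
- by rewrite rmorphM/= -rnormE -(l1_delta_norm (i, j)) TXY.
exact: T0.
Qed.

End MunnUnits.

(** * Derivations of a Munn algebra with an invertible entry *)

Section MunnDerivation.
Context {R : realType} {A : unitalBanachAlgType R} {I J : choiceType}.
Context {P : J -> I -> A} {P1 : (mx_supnorm P <= 1)%E}.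
Notation munn_unit := (@munn_unit R A I J P P1).
Notation munn_corner := (@munn_corner R A I J P P1).
Context {i0 : I} {j0 : J} {q : A}.
Hypothesis qP : bmul q (P j0 i0) = bone.

(** The factor q cancels the entry p that the product of matrices inserts. *)
Lemma munn_cornerM : {morph munn_corner i0 j0 q : a b / bmul a b}.
Proof.
by move=> a b; rewrite /= munn_unitM -!bmulA (bmulA q) qP bmul1l.
Qed.

Variable D : bop (LM P P1) (dual (LM P P1)).
Hypothesis derD : derivation D.

Let D0 := bpullback D (munn_corner i0 j0 q).

(** The functionals g_kj of the decomposition of D. *)
Definition munn_correction k j : dual A :=
  bcomp (D (munn_unit i0 j bone)) (munn_corner k j0 q).

(** Expanding D along a e_ij = q e_(i j0) o a q e_(i0 j0) o e_(i0 j) gives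
    h(a P_jk b) + D0(a)(P_jk b P_li) + g_kj(b P_li a), where
    h(c) = D(q e_(i j0))(c e_(i0 l)).  The embedded copy of P_li factors as
    e_(i0 l) o q e_(i j0), whence h(c) = D0(P_li)(c) - g_il(c); the two values
    of D0 then combine by the Leibniz rule for D0. *)
Lemma munn_derivationE i j k l a b :
  D (munn_unit i j a) (munn_unit k l b) =
  D0 (bmul (P l i) a) (bmul (P j k) b)
  + munn_correction k j (bmul (bmul b (P l i)) a)
  - munn_correction i l (bmul (bmul a (P j k)) b).
Proof.
have derD0 : derivation D0.
  by apply: derivation_bpullback derD; exact: munn_cornerM.
have -> : munn_unit i j a = bmul (munn_unit i j0 q) (munn_unit i0 j a).
  by rewrite munn_unitM qP bmul1l.
have E1 : munn_unit i0 j a =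
    bmul (munn_unit i0 j0 (bmul a q)) (munn_unit i0 j bone).
  by rewrite munn_unitM -(bmulA _ q) qP !bmul1r.
have E2 c : munn_unit i0 l c =
    bmul (munn_unit i0 j0 (bmul c q)) (munn_unit i0 l bone).
  by rewrite munn_unitM -(bmulA _ q) qP !bmul1r.
have E3 c : bmul (munn_unit i j0 q) (munn_unit i0 j0 (bmul c q)) =
    munn_unit i j0 (bmul c q).
  by rewrite munn_unitM qP bmul1l.
have E4 : munn_corner i0 j0 q (P l i) =
    bmul (munn_unit i0 l bone) (munn_unit i j0 q).
  by rewrite munn_unitM bmul1l.
(* h(c) = D0(P_li)(c) - g_il(c) *)
have E5 c : D0 (P l i) c = munn_correction i l c +
    D (munn_unit i j0 q) (munn_unit i0 l c).
  by rewrite {1}/D0 /= (E4 : munn_unit _ _ _ = _) (derivationE derD) E3 -E2.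
rewrite (derivationE derD) munn_unitM munn_unitM.
rewrite [in X in _ + D X _]E1 (derivationE derD) !munn_unitM bmul1l.
rewrite (derivationE derD0) E5 [in RHS]bmulA.
rewrite -(bmulA _ q (P j0 i0)) qP bmul1r !bmulA.
set c := munn_correction i l _; rewrite -2!(addrA c) [RHS]addrC addKr -addrA.
by [].
Qed.

Lemma munn_correction_bounded k j :
  `|munn_correction k j| <= (opnorm D * rnorm (bone : A) * rnorm q)%:C.
Proof.
apply: bop_norm_le => [|a]; first by rewrite !mulr_ge0 ?opnorm_ge0 ?rnorm_ge0.
apply: le_trans (opnorm_ub (D (munn_unit i0 j bone)) _) _.
rewrite rmorphM -mulrA ler_pM//; first by rewrite ler0c opnorm_ge0.
  apply: le_trans (opnorm_ub D _) _.
  rewrite rmorphM/= ler_wpM2l ?ler0c ?opnorm_ge0//.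
  by rewrite [leLHS]l1_delta_norm rnormE.
by rewrite /= -rnormE [leLHS]l1_delta_norm mulrC ler_norm_bmul.
Qed.

(** In ad_y, the entries c |-> x(P_jk c) produce
    x(P_jk b P_li a) - x(P_li a P_jk b) = ad_x (P_li a)(P_jk b), and the entries
    g_kj cancel the correction terms of [munn_derivationE]. *)
Lemma munn_ad_lift (x : dual A) : exists y : dual (LM P P1),
  forall i j k l a b,
    (ad y - D) (munn_unit i j a) (munn_unit k l b) =
    (ad x - D0) (bmul (P l i) a) (bmul (P j k) b).
Proof.
pose z (s : I * J) : dual A := ract x (P s.2 s.1) + munn_correction s.1 s.2.
have [s|y' yE] := @l1_functional _ _ _ z
    (opnorm x + opnorm D * rnorm (bone : A) * rnorm q).
  rewrite (le_trans (ler_normD _ _))// rmorphD/= lerD ?munn_correction_bounded//.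
  apply: bop_norm_le => [|a]; first exact: opnorm_ge0.
  apply: le_trans (opnorm_ub x _) _; rewrite ler_wpM2l ?ler0c ?opnorm_ge0//.
  exact: munn_entry_contraction.
pose y : dual (LM P P1) := y'.
have yP i j c : y (munn_unit i j c) =
    x (bmul (P j i) c) + munn_correction i j c by rewrite [LHS]yE.
have cancel (u v d g h : R[i]) :
    (u + g) - (v + h) - (d + g - h) = u - v - d by ring.
exists y => i j k l a b.
rewrite !ad_subE !munn_unitM !yP munn_derivationE cancel.
by rewrite !bmulA.
Qed.

End MunnDerivation.

(** * Transfer of amenability *)

Lemma directed_tails_filter (L : Type) (le : L -> L -> Prop) :
  directed_preorder le -> Filter (tails le).
Proof.
case=> -[l0] le_refl le_trans le_dir; apply: filter_from_filter.
  by exists l0.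
move=> l m _ _; have [n [ln mn]] := le_dir l m; exists n => // k nk.
by split; apply: le_trans nk.
Qed.

Theorem theorem3p8 (R : realType) (A : unitalBanachAlgType R)
    (I J : choiceType) (P : J -> I -> A)
    (P_neq0 : inhabited (J * I) -> exists j i, P j i <> 0%R)
    (P_inv : forall j i, P j i <> 0%R -> binvertible (P j i))
    (P_le1 : (mx_supnorm P <= 1)%E) :
  bounded_wstar_approx_weakly_amenable A ->
  bounded_wstar_approx_weakly_amenable (LM P P_le1).
Proof.
move=> wA D derD.
have [|noJI] := pselect (inhabited (J * I)); last first.
  have X0 (X : LM P P_le1) : X = 0.
    by apply: l1_eq => -[i j]; case: noJI; exact: inhabits (j, i).
  have dir : @directed_preorder unit (fun _ _ => True).
    by split=> //; exists tt.
  have FF := directed_tails_filter dir.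
  exists unit, (fun _ _ => True), (fun=> 0); split => //.
    by exists `|ad (0 : dual (LM P P_le1))|.
  by move=> X Y; rewrite (X0 X) !linear0; exact: cvg_cst.
move=> /P_neq0[j0 [i0 /P_inv[q [_ qP]]]].
pose D0 := bpullback D (munn_corner (P1 := P_le1) i0 j0 q).
have derD0 : derivation D0.
  by apply: derivation_bpullback derD; exact: munn_cornerM.
have [L [le [x [dir [M xM] xD0]]]] := wA D0 derD0.
have /choice[y yE] l := munn_ad_lift qP derD (x l).
have FF := directed_tails_filter dir.
have xD0M l : `|ad (x l) - D0| <= (rnorm M + opnorm D0)%:C.
  rewrite (le_trans (ler_normB _ _))// rmorphD/= lerD// -rnormE.
  rewrite (le_trans (xM l))//.
  by rewrite real_ler_norm// ger0_real// (le_trans _ (xM l)).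
have yDM l : `|ad (y l) - D| <= (rnorm M + opnorm D0)%:C.
  apply: munn_bop_norm_le => [|i j k m a b].
    by rewrite addr_ge0 ?rnorm_ge0 ?opnorm_ge0.
  rewrite yE (le_trans (opnorm_ub _ _))// ler_pM//.
  - by rewrite ler0c opnorm_ge0.
  - rewrite -bop_normE (le_trans (opnorm_ub _ _))// ler_pM//.
    + by rewrite ler0c opnorm_ge0.
    + exact: xD0M.
    exact: munn_entry_contraction.
  - exact: munn_entry_contraction.
exists L, le, y; split=> //.
  exists ((rnorm M + opnorm D0)%:C + `|D|) => l.
  by rewrite -[ad (y l)](subrK D) (le_trans (ler_normD _ _))// lerD2r yDM.
apply/weakstar_cvg_sub0; apply: (munn_weakstar_cvg0 FF yDM) => i j k m a b.
under eq_fun do rewrite yE.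
exact: ((weakstar_cvg_sub0 (fun l => ad (x l)) D0 FF).1 xD0).
Qed.
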